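(* Let $R$ be a $\phi$-ring. If $R$ is Gaussian, then $R$ is $\phi$-Prüfer.
   Context: All rings are commutative with nonzero identity. For a ring $R$, $\mathrm{Nil}(R)$ denotes the ideal of nilpotent elements, $Z(R)$ the set of zerodivisors and $T(R)$ the total quotient ring. For $f \in R[X]$, the content $c(f)$ is the ideal of $R$ generated by the coefficients of $f$. $R$ is a Gaussian ring if $c(fg) = c(f)c(g)$ for all $f, g \in R[X]$. A prime ideal $P$ of $R$ is called divided if it is comparable (under inclusion) to every ideal of $R$. $R$ is a $\phi$-ring if $\mathrm{Nil}(R)$ is a divided prime ideal of $R$. An ideal $I$ of $R$ is nonnil if $I \not\subseteq \mathrm{Nil}(R)$. For a $\phi$-ring $R$, let $\phi: T(R) \to R_{\mathrm{Nil}(R)}$ be the ring homomorphism $\phi(a/b) = a/b$ for $a\in R$, $b \in R\setminus Z(R)$; restricted to $R$ it is the ring homomorphism $x \mapsto x/1$, with image the ring $\phi(R)$. A nonnil ideal $I$ of a $\phi$-ring $R$ is $\phi$-invertible if $\phi(I)$ is an invertible ideal of $\phi(R)$, i.e. $\phi(I)\,\phi(I)^{-1} = \phi(R)$ where $\phi(I)^{-1} = \{x \in T(\phi(R)) : x\phi(I) \subseteq \phi(R)\}$. A $\phi$-ring $R$ is $\phi$-Prüfer if every finitely generated nonnil ideal of $R$ is $\phi$-invertible. *)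

(* Defs.v *)
From HB Require Import structures.
From mathcomp Require Import all_boot all_algebra ring.
From mathcomp Require Import boolp classical_sets.

Set Implicit Arguments.
Unset Strict Implicit.
Unset Printing Implicit Defensive.

Import GRing.Theory.
Local Open Scope classical_set_scope.
Local Open Scope ring_scope.
Local Open Scope quotient_scope.

Section Ideals.
Variable A : comPzRingType.
Implicit Types (I J : set A) (G : set A).

(* The improper ideal is allowed, unlike in [idealr_closed]. *)
Definition ideal I : Prop :=
  [/\ I 0, forall x y, I x -> I y -> I (x + y) & forall a x, I x -> I (a * x)].

Definition ideal_gen G : set A := smallest ideal G.

Definition ideal_mul I J : set A := ideal_gen [set x * y | x in I & y in J].

Definition fg_ideal I : Prop := exists s : seq A, I = ideal_gen [set` s].

Definition Nil : set A := [set x | exists n : nat, x ^+ n = 0].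

Definition zerodiv : set A := [set x | exists2 y, y != 0 & x * y = 0].

End Ideals.

Arguments Nil A : clear implicits.
Arguments zerodiv A : clear implicits.

Definition content (R : comNzRingType) (f : {poly R}) : set R :=
  ideal_gen [set` (f : seq R)].

Definition gaussian (R : comNzRingType) : Prop :=
  forall f g : {poly R}, content (f * g) = ideal_mul (content f) (content g).

(* [idealr_closed] includes properness. *)
Definition prime_ideal (R : comNzRingType) (P : set R) : Prop :=
  idealr_closed [in P] /\ prime_idealr_closed [in P].

Definition divided_prime (R : comNzRingType) (P : set R) : Prop :=
  prime_ideal P /\ forall I : set R, ideal I -> I `<=` P \/ P `<=` I.

Definition phi_ring (R : comNzRingType) : Prop := divided_prime (Nil R).

Definition nonnil (R : comNzRingType) (I : set R) : Prop := ~ I `<=` Nil R.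

Record mulset (A : comPzRingType) := MulSet {
  mulset_set :> set A;
  mulset1 : mulset_set 1;
  mulsetM : forall s t, mulset_set s -> mulset_set t -> mulset_set (s * t) }.

(* The localization of A at S.  It may be the zero ring, if 0 is in S. *)
Section Localization.
Variables (A : comPzRingType) (S : mulset A).

Definition one_den : S := exist _ 1 (mem_set (mulset1 S)).

Definition mul_den (s t : S) : S :=
  exist _ (sval s * sval t) (mem_set (mulsetM (set_valP s) (set_valP t))).

Definition loc_rel (x y : A * S) : bool :=
  `[< exists u : S, sval u * (x.1 * sval y.2) = sval u * (y.1 * sval x.2) >].

Lemma loc_rel_refl : reflexive loc_rel.
Proof. by move=> x; apply/asboolP; exists one_den. Qed.

Lemma loc_rel_sym : symmetric loc_rel.
Proof.
by move=> x y; apply/asboolP/asboolP => -[u e]; exists u; rewrite e.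
Qed.

Lemma loc_rel_trans : transitive loc_rel.
Proof.
move=> [b t] [a s] [c r] /asboolP [u /= e] /asboolP [v /= f]; apply/asboolP.
exists (mul_den (mul_den u v) t) => /=.
rewrite [LHS](_ : _ = (sval u * (a * sval t)) * (sval v * sval r)); last by ring.
rewrite e [LHS](_ : _ = (sval v * (b * sval r)) * (sval u * sval s)); last by ring.
by rewrite f; ring.
Qed.

Canonical loc_equiv := EquivRel loc_rel loc_rel_refl loc_rel_sym loc_rel_trans.

Definition loc : Type := {eq_quot loc_rel}.

HB.instance Definition _ := EqQuotient.on loc.
HB.instance Definition _ := Choice.on loc.

Definition frac (a : A) (s : S) : loc := \pi_loc (a, s).

Lemma frac_eqP a s b t :
  frac a s = frac b t <->
  exists u : S, sval u * (a * sval t) = sval u * (b * sval s).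
Proof.
split=> [/eqP|h]; first by rewrite /frac eqmodE => /asboolP.
by apply/eqP; rewrite /frac eqmodE; apply/asboolP.
Qed.

Lemma fracP (x : loc) : exists a s, x = frac a s.
Proof.
by exists (repr x).1, (repr x).2; rewrite /frac -surjective_pairing reprK.
Qed.

Lemma frac_repr (x : loc) : frac (repr x).1 (repr x).2 = x.
Proof. by rewrite /frac -surjective_pairing reprK. Qed.

Lemma frac_eq1 a s b t : a * sval t = b * sval s -> frac a s = frac b t.
Proof. by move=> e; apply/frac_eqP; exists one_den; rewrite e. Qed.

Definition loc_add (x y : loc) : loc :=
  frac ((repr x).1 * sval (repr y).2 + (repr y).1 * sval (repr x).2)
       (mul_den (repr x).2 (repr y).2).
Definition loc_opp (x : loc) : loc := frac (- (repr x).1) (repr x).2.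
Definition loc_mul (x y : loc) : loc :=
  frac ((repr x).1 * (repr y).1) (mul_den (repr x).2 (repr y).2).

Lemma loc_addE a s b t :
  loc_add (frac a s) (frac b t) = frac (a * sval t + b * sval s) (mul_den s t).
Proof.
have /frac_eqP [u] := frac_repr (frac a s).
have /frac_eqP [v] := frac_repr (frac b t).
rewrite /loc_add; case: (repr _) => b' t'; case: (repr _) => a' s' /= f e.
apply/frac_eqP; exists (mul_den u v) => /=.
rewrite [LHS](_ : _ = (sval u * (a' * sval s)) * (sval v * sval t' * sval t)
  + (sval v * (b' * sval t)) * (sval u * sval s' * sval s)); last by ring.
by rewrite e f; ring.
Qed.

Lemma loc_oppE a s : loc_opp (frac a s) = frac (- a) s.
Proof.
have /frac_eqP [u] := frac_repr (frac a s).
rewrite /loc_opp; case: (repr _) => a' s' /= e.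
by apply/frac_eqP; exists u; rewrite /= !mulNr !mulrN e.
Qed.

Lemma loc_mulE a s b t :
  loc_mul (frac a s) (frac b t) = frac (a * b) (mul_den s t).
Proof.
have /frac_eqP [u] := frac_repr (frac a s).
have /frac_eqP [v] := frac_repr (frac b t).
rewrite /loc_mul; case: (repr _) => b' t'; case: (repr _) => a' s' /= f e.
apply/frac_eqP; exists (mul_den u v) => /=.
rewrite [LHS](_ : _ = (sval u * (a' * sval s)) * (sval v * (b' * sval t)));
  last by ring.
by rewrite e f; ring.
Qed.

Lemma loc_addA : associative loc_add.
Proof.
move=> x y z; have [a [s ->]] := fracP x; have [b [t ->]] := fracP y.
have [c [r ->]] := fracP z; rewrite !loc_addE; apply: frac_eq1 => /=; ring.
Qed.

Lemma loc_addC : commutative loc_add.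
Proof.
move=> x y; have [a [s ->]] := fracP x; have [b [t ->]] := fracP y.
rewrite !loc_addE; apply: frac_eq1 => /=; ring.
Qed.

Lemma loc_add0 : left_id (frac 0 one_den) loc_add.
Proof.
move=> x; have [a [s ->]] := fracP x.
rewrite !loc_addE; apply: frac_eq1 => /=; ring.
Qed.

Lemma loc_addN : left_inverse (frac 0 one_den) loc_opp loc_add.
Proof.
move=> x; have [a [s ->]] := fracP x.
rewrite loc_oppE !loc_addE; apply: frac_eq1 => /=; ring.
Qed.

Lemma loc_mulA : associative loc_mul.
Proof.
move=> x y z; have [a [s ->]] := fracP x; have [b [t ->]] := fracP y.
have [c [r ->]] := fracP z; rewrite !loc_mulE; apply: frac_eq1 => /=; ring.
Qed.

Lemma loc_mulC : commutative loc_mul.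
Proof.
move=> x y; have [a [s ->]] := fracP x; have [b [t ->]] := fracP y.
rewrite !loc_mulE; apply: frac_eq1 => /=; ring.
Qed.

Lemma loc_mul1 : left_id (frac 1 one_den) loc_mul.
Proof.
move=> x; have [a [s ->]] := fracP x.
rewrite !loc_mulE; apply: frac_eq1 => /=; ring.
Qed.

Lemma loc_mulDl : left_distributive loc_mul loc_add.
Proof.
move=> x y z; have [a [s ->]] := fracP x; have [b [t ->]] := fracP y.
have [c [r ->]] := fracP z.
rewrite !(loc_mulE, loc_addE); apply: frac_eq1 => /=; ring.
Qed.

HB.instance Definition _ :=
  GRing.isZmodule.Build loc loc_addA loc_addC loc_add0 loc_addN.
HB.instance Definition _ :=
  GRing.Zmodule_isComPzRing.Build loc loc_mulA loc_mulC loc_mul1 loc_mulDl.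

Lemma fracD a s b t :
  frac a s + frac b t = frac (a * sval t + b * sval s) (mul_den s t).
Proof. exact: loc_addE. Qed.

Lemma fracN a s : - frac a s = frac (- a) s.
Proof. exact: loc_oppE. Qed.

Lemma fracM a s b t : frac a s * frac b t = frac (a * b) (mul_den s t).
Proof. exact: loc_mulE. Qed.

Lemma frac0 : frac 0 one_den = 0. Proof. by []. Qed.

Lemma frac1 : frac 1 one_den = 1. Proof. by []. Qed.

Definition to_loc (a : A) : loc := frac a one_den.

Lemma to_loc_zmod : zmod_morphism to_loc.
Proof.
by move=> a b; rewrite /to_loc fracN fracD; apply: frac_eq1 => /=; ring.
Qed.

Lemma to_loc_monoid : monoid_morphism to_loc.
Proof.
by split=> // a b; rewrite /to_loc fracM; apply: frac_eq1 => /=; ring.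
Qed.

HB.instance Definition _ := GRing.isZmodMorphism.Build A loc to_loc to_loc_zmod.
HB.instance Definition _ :=
  GRing.isMonoidMorphism.Build A loc to_loc to_loc_monoid.

End Localization.

Section TotalQuotientRing.
Variable A : comPzRingType.

Lemma nonzerodiv1 : (~` zerodiv A) 1.
Proof. by move=> [y /eqP y0]; rewrite mul1r. Qed.

Lemma nonzerodivM s t :
  (~` zerodiv A) s -> (~` zerodiv A) t -> (~` zerodiv A) (s * t).
Proof.
move=> hs ht [y y0 e]; apply: hs; exists (t * y); last by rewrite mulrA.
by apply/eqP => ty; apply: ht; exists y.
Qed.

Definition regular : mulset A := MulSet nonzerodiv1 nonzerodivM.

Definition tot : comPzRingType := loc regular.

Definition to_tot : {rmorphism A -> tot} := @to_loc A regular.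

Definition submod (M : set tot) : Prop :=
  [/\ M 0, forall x y, M x -> M y -> M (x + y)
    & forall a x, M x -> M (to_tot a * x)].

Definition submod_mul (M N : set tot) : set tot :=
  smallest submod [set x * y | x in M & y in N].

Definition ideal_inv (I : set A) : set tot :=
  [set x | forall a, I a -> range to_tot (x * to_tot a)].

Definition invertible_ideal (I : set A) : Prop :=
  submod_mul (to_tot @` I) (ideal_inv I) = range to_tot.

End TotalQuotientRing.

Arguments regular A : clear implicits.
Arguments tot A : clear implicits.
Arguments to_tot {A}.

Section Phi.
Variables (R : comNzRingType) (hR : phi_ring R).

Lemma nonnilpotent1 : (~` Nil R) 1.
Proof. by move=> [n /eqP]; rewrite expr1n oner_eq0. Qed.

Lemma nonnilpotentM s t :
  (~` Nil R) s -> (~` Nil R) t -> (~` Nil R) (s * t).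
Proof.
move=> hs ht hst; case: hR => -[_ /(_ s t)]; rewrite !inE.
by move=> /(_ hst) /orP[]; rewrite inE.
Qed.

Definition non_nil : mulset R := MulSet nonnilpotent1 nonnilpotentM.

Definition loc_nil : comPzRingType := loc non_nil.

Lemma regular_non_nil (b : regular R) : sval b \in (non_nil : set R).
Proof.
apply/mem_set => -[n bn]; apply: (set_valP b) => /=.
elim: n bn => [|n IHn]; first by move/eqP; rewrite expr0 oner_eq0.
rewrite exprS => bn; have [/IHn//|n0] := eqVneq (sval b ^+ n) 0.
by exists (sval b ^+ n).
Qed.

Definition phi (x : tot R) : loc_nil :=
  frac (repr x).1 (exist _ (sval (repr x).2) (regular_non_nil (repr x).2)).

Lemma phi_frac (a : R) (b : regular R) :
  phi (frac a b) = frac a (exist _ (sval b) (regular_non_nil b)).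
Proof.
have /frac_eqP [u] := frac_repr (frac a b); rewrite /phi.
case: (repr _) => a' b' /= e; apply/frac_eqP.
by exists (exist _ (sval u) (regular_non_nil u)).
Qed.

Lemma phi_to_tot (x : R) : phi (to_tot x) = to_loc non_nil x.
Proof. by rewrite phi_frac; apply: frac_eq1. Qed.

Lemma phi_zmod : zmod_morphism phi.
Proof.
move=> x y; have [a [s ->]] := fracP x; have [b [t ->]] := fracP y.
by rewrite fracN fracD !phi_frac fracN fracD; apply: frac_eq1.
Qed.

Lemma phi_monoid : monoid_morphism phi.
Proof.
split; first by rewrite -frac1 phi_frac -frac1; apply: frac_eq1.
move=> x y; have [a [s ->]] := fracP x; have [b [t ->]] := fracP y.
by rewrite fracM !phi_frac fracM; apply: frac_eq1.
Qed.

HB.instance Definition _ :=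
  GRing.isZmodMorphism.Build (tot R) loc_nil phi phi_zmod.
HB.instance Definition _ :=
  GRing.isMonoidMorphism.Build (tot R) loc_nil phi phi_monoid.

Definition phi_image : {pred loc_nil} := [in range (fun x : R => phi (to_tot x))].

Lemma phi_image_subring : subring_closed phi_image.
Proof.
split=> [|_ _ /set_mem[x _ <-] /set_mem[y _ <-]|_ _ /set_mem[x _ <-] /set_mem[y _ <-]];
  apply/mem_set.
- by exists 1; rewrite // !rmorph1.
- by exists (x - y); rewrite // !rmorphB.
- by exists (x * y); rewrite // !rmorphM.
Qed.

(* The ring phi(R), as a subring of the localization of R at Nil(R). *)
Record phiR := PhiR { phiR_val :> loc_nil; _ : phiR_val \in phi_image }.

HB.instance Definition _ := [isSub for phiR_val].
HB.instance Definition _ := [Choice of phiR by <:].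
HB.instance Definition _ :=
  GRing.SubChoice_isSubComPzRing.Build loc_nil phi_image phiR phi_image_subring.

Definition phi_ideal (I : set R) : set phiR :=
  [set y | exists2 x, I x & val y = phi (to_tot x)].

Definition phi_invertible (I : set R) : Prop := invertible_ideal (phi_ideal I).

Definition phi_prufer : Prop :=
  forall I : set R, ideal I -> fg_ideal I -> nonnil I -> phi_invertible I.

End Phi.

(* Main.v *)
Require Import Defs.
From HB Require Import structures.
From mathcomp Require Import all_boot all_algebra ring.
From mathcomp Require Import boolp classical_sets.
Import Defs.

(** Let [q : R -> phi(R)] be the quotient map. Its kernel consists of the
    elements killed by a non-nilpotent one, so [q a] is regular as soon as [a]
    is not nilpotent. An ideal [J] of any ring is invertible when [1] lies in
    the sum of the colon ideals [((a) : J)], over the regular [a] in [J]: an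
    element [e] of such a colon ideal is [a * (e / a)], with [e / a] in the
    inverse of [J] ([invertible_of_colons]).

    For [J = phi(I)] with [I] finitely generated, this is reached by adding the
    generators one at a time ([colons_comaximal]). The step compares two
    elements [a], [b], with [a] not nilpotent ([gaussian_comparable]): some [z]
    satisfies [z * a] in [(b)] and [(1 - z) * b] in [(a)], up to elements killed
    by a power of [a]. Such a [z] splits every element of a colon ideal of [a]
    into one that also sends [b] into [(a)] and one that belongs to a colon
    ideal of [b]. If [b] is nilpotent, it cannot serve as a denominator, but
    then [a] divides [b], because [Nil(R)] is divided, and nothing has to be
    changed.

    The comparison is where the Gaussian property enters, twice. The product
    [(aX + b)(aX - b)] shows that [ab = x a^2 + y b^2] for some [x], [y]. Hence
    [w = yb/a] is a root of [T^2 - T + xy], whose other root is [1 - w]. Clearing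
    denominators in this factorization and comparing contents shows that [w]
    belongs to the ring, which is the usual argument that a Gaussian domain is
    integrally closed; finally [(1 - w) b = x a] and [w a = y b]. *)

Set Implicit Arguments.
Unset Strict Implicit.
Unset Printing Implicit Defensive.

Import GRing.Theory.
Local Open Scope classical_set_scope.
Local Open Scope ring_scope.

(** * Generated ideals *)

Section GeneratedIdeals.
Variable A : comPzRingType.
Implicit Types I G : set A.

Lemma ideal_gen_ideal G : ideal (ideal_gen G).
Proof.
split=> [I [[]]//|x y hx hy I [hI GI]|a x hx I [hI GI]].
- by case: (hI) => _ hD _; apply: hD; [apply: hx | apply: hy].
- by case: (hI) => _ _ hM; apply: hM; apply: hx.
Qed.

Lemma sub_ideal_gen G : G `<=` ideal_gen G.
Proof. by move=> x Gx I [_]; apply. Qed.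

Lemma ideal_gen_min G I : ideal I -> G `<=` I -> ideal_gen G `<=` I.
Proof. by move=> hI GI x; apply. Qed.

Lemma principal_ideal (a : A) : ideal [set c * a | c in setT].
Proof.
split=> [|_ _ [c _ <-] [d _ <-]|b _ [c _ <-]].
- by exists 0; rewrite // mul0r.
- by exists (c + d); rewrite // mulrDl.
- by exists (b * c); rewrite // mulrA.
Qed.

End GeneratedIdeals.

(** * Invertibility from colon ideals *)

Section Invertibility.
Variable A : comPzRingType.

Lemma submod_range : submod (range (@to_tot A)).
Proof.
split=> [|_ _ [a _ <-] [b _ <-]|a _ [b _ <-]].
- by exists 0; rewrite // rmorph0.
- by exists (a + b); rewrite // rmorphD.
- by exists (a * b); rewrite // rmorphM.
Qed.

Lemma submod_mul_submod (M N : set (tot A)) : submod (submod_mul M N).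
Proof.
split=> [P [[]]//|x y hx hy P [hP hMN]|a x hx P [hP hMN]].
- by case: (hP) => _ hD _; apply: hD; [apply: hx | apply: hy].
- by case: (hP) => _ _ hM; apply: hM; apply: hx.
Qed.

(** The inverse of [I] is not known in advance; the colon ideals provide
    elements of it, namely the fractions [e / a]. *)
Lemma invertible_of_colons (I : set A) :
  ideal_gen [set e | exists a, [/\ I a, (~` zerodiv A) a
                               & forall b, I b -> exists c, e * b = c * a]] 1 ->
  invertible_ideal I.
Proof.
move=> h1; rewrite /invertible_ideal; apply/seteqP; split=> [x|].
  apply; split; first exact: submod_range.
  by move=> _ [_ [a Ia <-]] [y hy <-]; rewrite mulrC; apply: hy.
have [m0 mD mM] := submod_mul_submod (to_tot @` I) (ideal_inv I).
have hP : ideal (to_tot @^-1` submod_mul (to_tot @` I) (ideal_inv I)).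
  split=> [|x y hx hy|a x hx] /=.
  - by rewrite rmorph0.
  - by rewrite rmorphD; apply: mD.
  - by rewrite rmorphM; apply: mM.
suff P1 : submod_mul (to_tot @` I) (ideal_inv I) (to_tot 1).
  by move=> _ [x _ <-]; rewrite -[x]mulr1 rmorphM; apply: mM.
apply: (ideal_gen_min hP) h1 => e [a [Ia ra he]] /= P [_]; apply.
exists (to_tot a); first by exists a.
exists (frac e (exist _ a (mem_set ra) : regular A)).
  move=> b /he[c ec]; exists c => //.
  by rewrite /= /to_loc fracM; apply: frac_eq1; rewrite /= !mulr1 ec.
by rewrite /= /to_loc fracM; apply: frac_eq1 => /=; ring.
Qed.

End Invertibility.

(** * Comparing two elements of a Gaussian ring *)

Section Gaussian.
Variable R : comNzRingType.

Lemma gaussian_coef_mul (f g : {poly R}) (J : set R) i j :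
  gaussian R -> ideal J -> (forall k, J (f * g)`_k) -> J (f`_i * g`_j).
Proof.
move=> gR hJ hfg.
have coefP (h : {poly R}) k : content h h`_k.
  have [hk|hk] := ltnP k (size h).
    by apply: sub_ideal_gen => /=; apply: mem_nth.
  by rewrite nth_default //; case: (ideal_gen_ideal [set` (h : seq R)]).
have : content (f * g) (f`_i * g`_j).
  by rewrite gR; apply: sub_ideal_gen; exists f`_i => //; exists g`_j.
by apply: ideal_gen_min => // _ /= /(nthP 0)[k _ <-].
Qed.

Lemma gaussian_mul_mem (a b : R) :
  gaussian R -> exists x y, a * b = x * a ^+ 2 + y * b ^+ 2.
Proof.
move=> gR.
pose J := [set u | exists x y, u = x * a ^+ 2 + y * b ^+ 2].
have hJ : ideal J.
  split=> [|_ _ [x [y ->]] [x' [y' ->]]|c _ [x [y ->]]].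
  - by exists 0, 0; ring.
  - by exists (x + x'), (y + y'); ring.
  - by exists (c * x), (c * y); ring.
have := @gaussian_coef_mul (a *: 'X + b%:P) (a *: 'X - b%:P) J 0 1 gR hJ.
rewrite !(coefB, coefD, coefZ, coefX, coefC) /=.
rewrite mulr0 add0r mulr1 subr0 [b * a]mulrC; apply=> k.
have -> : (a *: 'X + b%:P) * (a *: 'X - b%:P)
          = a ^+ 2 *: 'X^2 - (b ^+ 2)%:P :> {poly R}.
  by rewrite -!mul_polyC !rmorphXn /=; ring.
rewrite coefB coefZ coefXn coefC.
by exists (k == 2)%:R, (- (k == 0)%:R); case: k => [|k] /=; ring.
Qed.

(** In a domain, [z] is the fraction [y b / a], which is integral, hence in the
    ring. As [a] may be a zerodivisor here, the equalities [z a = y b] and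
    [(1 - z) b = x a] only hold after multiplication by powers of [a]. *)
Lemma gaussian_comparable (a b : R) : gaussian R ->
  exists x y z, a * (z * a - y * b) = 0 /\ a ^+ 2 * ((1 - z) * b - x * a) = 0.
Proof.
move=> gR; have [x [y e]] := gaussian_mul_mem a b gR.
have hJ := principal_ideal (a ^+ 2).
have := @gaussian_coef_mul (a *: 'X - (y * b)%:P) (a *: 'X - (a - y * b)%:P)
  _ 0 1 gR hJ.
case=> [k|z _].
  (* The factorization of T^2 - T + xy, scaled by a^2. *)
  have -> : (a *: 'X - (y * b)%:P) * (a *: 'X - (a - y * b)%:P)
            = a ^+ 2 *: ('X^2 - 'X + (x * y)%:P) :> {poly R}.
    rewrite -!mul_polyC.
    have E : y%:P * b%:P * (a%:P - y%:P * b%:P)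
             = a%:P ^+ 2 * (x%:P * y%:P) :> {poly R}.
      rewrite -!(rmorphM, rmorphB, rmorphXn) /=; congr (_%:P).
      have -> : y * b * (a - y * b) = y * (a * b - y * b ^+ 2) by ring.
      by rewrite e; ring.
    rewrite !(rmorphM, rmorphB, rmorphXn) /= [RHS]mulrDr -E; ring.
  by rewrite coefZ; exists ('X^2 - 'X + (x * y)%:P)`_k; rewrite // mulrC.
rewrite !(coefB, coefZ, coefX, coefC) /= mulr0 mulr1 sub0r subr0 => ez.
have e1 : a * (- z * a - y * b) = 0.
  have -> : a * (- z * a - y * b) = - (z * a ^+ 2) + - (y * b) * a by ring.
  by rewrite -ez; ring.
exists x, y, (- z); split=> //.
have -> : a ^+ 2 * ((1 - - z) * b - x * a)
          = a * (a * b - x * a ^+ 2 - y * b ^+ 2)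
            - b * (a * (- z * a - y * b)) by ring.
by rewrite e1 e; ring.
Qed.

End Gaussian.

(** * The ring phi(R) *)

Section PhiRing.
Variables (R : comNzRingType) (hR : phi_ring R).

Definition to_phiR (x : R) : phiR hR :=
  PhiR (mem_set (imageT (fun x => phi hR (to_tot x)) x)).

Lemma to_phiR_zmod : zmod_morphism to_phiR.
Proof. by move=> x y; apply: val_inj; rewrite rmorphB /= !rmorphB. Qed.

Lemma to_phiR_monoid : monoid_morphism to_phiR.
Proof.
split=> [|x y]; apply: val_inj; first by rewrite rmorph1 /= !rmorph1.
by rewrite rmorphM /= !rmorphM.
Qed.

HB.instance Definition _ :=
  GRing.isZmodMorphism.Build R (phiR hR) to_phiR to_phiR_zmod.
HB.instance Definition _ :=
  GRing.isMonoidMorphism.Build R (phiR hR) to_phiR to_phiR_monoid.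

Lemma to_phiR_surj (y : phiR hR) : exists x, y = to_phiR x.
Proof.
by have /set_mem[x _ e] := valP y; exists x; apply: val_inj; rewrite -e.
Qed.

Lemma to_phiR_eq0 (x : R) :
  to_phiR x = 0 <-> exists2 s, (~` Nil R) s & s * x = 0.
Proof.
have -> : (to_phiR x = 0) <-> (to_loc (non_nil hR) x = 0).
  rewrite -phi_to_tot; split=> [e|e]; last by apply: val_inj; rewrite rmorph0.
  by have := congr1 val e; rewrite rmorph0.
rewrite -frac0 frac_eqP /=; split=> [[[s hs]] /=|[s hs e]].
  by rewrite mulr1 mul0r mulr0 => e; exists s => //; apply: set_mem hs.
by exists (exist _ s (mem_set hs)); rewrite /= mulr1 mul0r mulr0.
Qed.

Lemma to_phiR_cancel (a x : R) : (~` Nil R) a -> a * x = 0 -> to_phiR x = 0.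
Proof. by move=> ha e; apply/to_phiR_eq0; exists a. Qed.

Lemma to_phiR_regular (a : R) :
  (~` Nil R) a -> (~` zerodiv (phiR hR)) (to_phiR a).
Proof.
move=> ha [y y0]; have [x ex] := to_phiR_surj y; rewrite ex -rmorphM.
move=> /to_phiR_eq0[s hs e]; move/eqP: y0; apply; rewrite ex.
apply/to_phiR_eq0; exists (s * a); last by rewrite -mulrA.
exact: (nonnilpotentM hR).
Qed.

Lemma phi_idealE (I : set R) : @phi_ideal R hR I = to_phiR @` I.
Proof.
apply/seteqP; split=> [y [x Ix e]|_ [x Ix <-]]; last by exists x.
by exists x => //; apply: val_inj.
Qed.

Lemma nonnil_dvd_nil (a b : R) :
  (~` Nil R) a -> Nil R b -> exists c, b = c * a.
Proof.
move=> ha hb; case: hR => _ /(_ _ (principal_ideal a)) [] h; last first.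
  by have [c _ <-] := h _ hb; exists c.
by case: ha; apply: h; exists 1; rewrite // mul1r.
Qed.

Lemma phi_comparable (a b : R) : gaussian R -> (~` Nil R) a ->
  exists x y z : phiR hR, z * to_phiR a = y * to_phiR b /\
    (1 - z) * to_phiR b = x * to_phiR a.
Proof.
move=> gR ha; have [x [y [z [e1 e2]]]] := gaussian_comparable a b gR.
have ha2 : (~` Nil R) (a ^+ 2) by rewrite expr2; apply: (nonnilpotentM hR).
exists (to_phiR x), (to_phiR y), (to_phiR z).
by split; apply/eqP; rewrite -subr_eq0 -?(rmorph1 to_phiR);
   rewrite -!(rmorphM, rmorphB); apply/eqP;
   [exact: to_phiR_cancel e1 | exact: to_phiR_cancel e2].
Qed.

(** The denominators [a] range over the whole of [I] rather than over [s], so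
    that the induction on [s] can start from the empty sequence with an
    arbitrary non-nilpotent element of [I]. *)
Lemma colons_comaximal (I : set R) (s : seq R) :
  gaussian R -> nonnil I -> [set` s] `<=` I ->
  ideal_gen [set e : phiR hR | exists a, [/\ I a, (~` Nil R) a
    & forall b, b \in s -> exists c, e * to_phiR b = c * to_phiR a]] 1.
Proof.
move=> gR nI; elim: s => [|b s IHs] sI.
  have [a Ia ha] : exists2 a, I a & (~` Nil R) a.
    apply: contrapT => h; apply: nI => a Ia.
    by apply: contrapT => ha; apply: h; exists a.
  by apply: sub_ideal_gen; exists a.
have Ib : I b by apply: sI; rewrite /= mem_head.
have {}IHs := IHs (fun x (xs : x \in s) => sI x (@mem_behead _ (b :: s) x xs)).
apply: ideal_gen_min IHs; first exact: ideal_gen_ideal.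
move=> e [a [Ia ha he]].
have [nb|hb] := pselect (Nil R b).
  apply: sub_ideal_gen; exists a; split=> // b'; rewrite inE.
  case/predU1P=> [->|/he//]; have [c ->] := nonnil_dvd_nil ha nb.
  by exists (e * to_phiR c); rewrite rmorphM mulrA.
have [x [y [z [e1 e2]]]] := phi_comparable b gR ha.
have -> : e = (1 - z) * e + z * e by ring.
have [_ hD _] := ideal_gen_ideal [set e : phiR hR | exists a,
  [/\ I a, (~` Nil R) a
    & forall b', b' \in b :: s -> exists c, e * to_phiR b' = c * to_phiR a]].
apply: hD; apply: sub_ideal_gen.
  exists a; split=> // b'; rewrite inE => /predU1P[->|/he[c ec]].
    by exists (e * x); rewrite -!mulrA -e2; ring.
  by exists ((1 - z) * c); rewrite -!mulrA ec.
exists b; split=> // b'; rewrite inE => /predU1P[->|/he[c ec]].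
  by exists (z * e).
by exists (c * y); rewrite -!mulrA -e1 ec; ring.
Qed.

End PhiRing.

Theorem corollary2p10 (R : comNzRingType) (hR : phi_ring R) :
  gaussian R -> phi_prufer hR.
Proof.
move=> gR I _ [s Is] nI; apply: invertible_of_colons; rewrite phi_idealE.
have sI : [set` s] `<=` I by rewrite Is; apply: sub_ideal_gen.
have h1 := colons_comaximal (hR := hR) gR nI sI.
apply: ideal_gen_min h1; first exact: ideal_gen_ideal.
move=> e [a [Ia ha he]]; apply: sub_ideal_gen; exists (to_phiR hR a); split.
- by exists a.
- exact: to_phiR_regular.
(* The elements that e sends into (a) form an ideal, hence it suffices that
   they include the generators of I. *)
have hJ : ideal [set b | exists c, e * to_phiR hR b = c * to_phiR hR a].
  split=> [|b b' [c ec] [c' ec']|d b [c ec]].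
  - by exists 0; rewrite rmorph0 mulr0 mul0r.
  - by exists (c + c'); rewrite rmorphD mulrDr ec ec' mulrDl.
  - by exists (to_phiR hR d * c); rewrite rmorphM mulrCA ec mulrA.
by move=> _ [b + <-]; rewrite Is; apply: (ideal_gen_min hJ).
Qed.
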